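(* The space $\widehat{\mathcal{H}}_\mu$ has the following properties: (i) If $f\in\widehat{\mathcal{H}}_\mu$ has a non-real zero $w$, then the function $g(z):=\dfrac{z-\overline{w}}{z-w}f(z)$ also belongs to $\widehat{\mathcal{H}}_\mu$. (ii) For every $z\in\mathbb{C}\setminus\operatorname{Sp}(A_\infty)$, the evaluation functional $f\mapsto f(z)$ on $\widehat{\mathcal{H}}_\mu$ is continuous. (iii) For every $f\in\widehat{\mathcal{H}}_\mu$, the function $g(z):=\overline{f(\overline{z})}$ belongs to $\widehat{\mathcal{H}}_\mu$.
   Context: Let $\mathcal{H}$ be a separable Hilbert space with inner product $\langle\cdot,\cdot\rangle$ anti-linear in the first argument. Let $A$ be a (possibly unbounded) self-adjoint operator in $\mathcal{H}$ with discrete spectrum of multiplicity one (its spectrum consists only of isolated eigenvalues, each of multiplicity one). Let $\mu\in\mathcal{H}$ be a cyclic vector for $A$ (i.e. $\{(A-zI)^{-1}\mu : z\in\mathbb{C}\setminus\operatorname{Sp}(A)\}$ is a total set in $\mathcal{H}$) with $\|\mu\|=1$. $\operatorname{Sp}(\cdot)$ denotes the spectrum. Let $F(z):=\langle\mu,(A-zI)^{-1}\mu\rangle$ for $z\notin\operatorname{Sp}(A)$; this is a meromorphic function on $\mathbb{C}$. $A_\infty$ denotes the infinite-coupling member ($h=\infty$) of the family $A_h:=A+h\langle\mu,\cdot\rangle\mu$ of rank-one perturbations of $A$; its spectrum is $\operatorname{Sp}(A_\infty)=\{x\in\mathbb{R}:F(x)=0\}$. Define $\xi(z):=\dfrac{(A-\overline{z}I)^{-1}\mu}{F(\overline{z})}$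 for $z\in\mathbb{C}\setminus\operatorname{Sp}(A_\infty)$, where at points of $\operatorname{Sp}(A)$ (poles of $F$) the value is understood as the limit. For $\varphi\in\mathcal{H}$ define $(\Phi_\mu\varphi)(z):=\langle\xi(z),\varphi\rangle$, $z\in\mathbb{C}\setminus\operatorname{Sp}(A_\infty)$. The map $\Phi_\mu$ is linear and injective on $\mathcal{H}$; put $\widehat{\mathcal{H}}_\mu:=\Phi_\mu\mathcal{H}$, a linear space of meromorphic functions. $\widehat{\mathcal{H}}_\mu$ carries the norm transported from $\mathcal{H}$, $\|\Phi_\mu\varphi\|:=\|\varphi\|$. In (i), $g$ is defined at $z=w$ by removing the singularity. *)

(* Defs.v *)
(* MathComp-Analysis; the scalar field is R[i] for an arbitrary R : realType.
   R[i]^o is R[i] with the topology and the normed module structure induced by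
   its modulus.  Norms take values in R[i]. *)
From HB Require Import structures.
From mathcomp Require Export all_boot all_order all_algebra.
From mathcomp Require Export sesquilinear complex.
From mathcomp Require Export all_classical all_reals all_analysis.
Export numFieldNormedType.Exports.
Export Order.TTheory GRing.Theory Num.Theory.

Set Implicit Arguments.
Unset Strict Implicit.
Unset Printing Implicit Defensive.

Local Open Scope classical_set_scope.
Local Open Scope ring_scope.

Section InnerProduct.
Context {R : realType} {H : completeNormedModType R[i]}.

(* MathComp's dot products are linear in the first argument and conjugate-linear
   in the second one; [ip] follows the opposite convention. *)
Definition ip (dot : {dot H for @Num.conj R[i]}) (x y : H) : R[i] := dot y x.

(* [H] is complete by its type, hence a Hilbert space for such a [dot]. *)
Definition inner_product_norm (dot : {dot H for @Num.conj R[i]}) : Prop :=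
  forall x : H, `|x| ^+ 2 = ip dot x x.

End InnerProduct.

Definition separable_space (T : topologicalType) : Prop :=
  exists2 S : set T, countable S & dense S.

Definition linear_span (K : numFieldType) (V : lmodType K) (S : set V) : set V :=
  [set x | exists (n : nat) (c : 'I_n -> K) (v : 'I_n -> V),
     (forall i, S (v i)) /\ x = \sum_(i < n) c i *: v i].

(* The values of [op_fun] off [op_dom] are meaningless. *)
Record unbounded_op (K : numFieldType) (V : lmodType K) := UnboundedOp {
  op_dom : set V ;
  op_fun :> V -> V ;
  op_dom_submod : submod_closed [in op_dom] ;
  op_linear : forall (a : K) (x y : V), op_dom x -> op_dom y ->
    op_fun (a *: x + y) = a *: op_fun x + op_fun y }.

Section Operators.
Context {R : realType} {H : completeNormedModType R[i]}.
Variables (dot : {dot H for @Num.conj R[i]}) (A : unbounded_op H).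

Definition adjoint_graph : set (H * H) :=
  [set p | forall x, op_dom A x -> ip dot p.2 x = ip dot p.1 (A x)].

Definition op_graph : set (H * H) :=
  [set p | op_dom A p.1 /\ p.2 = A p.1].

Definition self_adjoint : Prop :=
  dense (op_dom A) /\ adjoint_graph = op_graph.

Definition shifted_op (z : R[i]) (x : H) : H := A x - z *: x.

(* (A - z I)^-1, with a junk value where the inverse does not exist. *)
Definition resolvent (z : R[i]) (y : H) : H :=
  xget 0 [set x | op_dom A x /\ shifted_op z x = y].

Definition resolvent_set : set R[i]^o :=
  [set z | set_bij (op_dom A) setT (shifted_op z) /\ continuous (resolvent z)].

Definition spectrum : set R[i]^o := ~` resolvent_set.

Definition simple_eigenvalue (l : R[i]) : Prop :=
  exists e : H, [/\ op_dom A e, e != 0, A e = l *: e &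
    forall x, op_dom A x -> A x = l *: x -> exists c : R[i], x = c *: e].

Definition discrete_simple_spectrum : Prop :=
  forall l, spectrum l -> isolated spectrum l /\ simple_eigenvalue l.

Definition cyclic_vector (mu : H) : Prop :=
  dense (linear_span [set resolvent z mu | z in resolvent_set]).

End Operators.

Section FunctionalModel.
Context {R : realType} {H : completeNormedModType R[i]}.
Variables (dot : {dot H for @Num.conj R[i]}) (A : unbounded_op H) (mu : H).

Definition weylF (z : R[i]) : R[i] := ip dot mu (resolvent A z mu).

(* The spectrum of the infinite-coupling perturbation of A by mu, given as the
   set of real zeros of weylF; weylF has no value on the spectrum of A. *)
Definition spectrum_infty : set R[i]^o :=
  [set x | [/\ x \is Num.real, resolvent_set A x & weylF x = 0]].

Definition xi_formula (z : R[i]^o) : H := (weylF z^*)^-1 *: resolvent A z^* mu.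

Definition xi (z : R[i]^o) : H :=
  if z \in spectrum A then lim (xi_formula u @[u --> z^']) else xi_formula z.

Definition Phi (phi : H) (z : R[i]^o) : R[i]^o := ip dot (xi z) phi.

(* A function on the complement of [spectrum_infty] is represented by any total
   function: its values on [spectrum_infty] are irrelevant. *)
Definition represents (phi : H) (f : R[i]^o -> R[i]^o) : Prop :=
  forall z, ~ spectrum_infty z -> f z = Phi phi z.

Definition Hhat : set (R[i]^o -> R[i]^o) :=
  [set f | exists phi, represents phi f].

(* The preimage is unique because Phi is injective. *)
Definition Hhat_norm (f : R[i]^o -> R[i]^o) : R[i] :=
  `|xget 0 [set phi | represents phi f]|.

Definition Hhat_continuous (ev : (R[i]^o -> R[i]^o) -> R[i]^o) : Prop :=
  forall f, Hhat f -> forall e : R[i], 0 < e ->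
  exists2 d : R[i], 0 < d &
    forall g, Hhat g -> Hhat_norm (g - f) < d -> `|ev g - ev f| < e.

End FunctionalModel.

Section ZeroSwap.
Context {R : realType}.
Variables (f : R[i]^o -> R[i]^o) (w : R[i]^o).

Let quotient (z : R[i]^o) : R[i]^o := (z - w^*) / (z - w) * f z.

(* The value at w is obtained by removing the singularity. *)
Definition swap_zero (z : R[i]^o) : R[i]^o :=
  if z == w then lim (quotient u @[u --> w^']) else quotient z.

End ZeroSwap.

(* Main.v *)
(** In the model space, multiplication of Phi phi by (z - w^* ) / (z - w) at a
    zero w is the action on phi of the Cayley transform
    (A - w^* ) (A - w)^-1 = 1 + (w - w^* ) (A - w)^-1, by the resolvent identity.
    The conjugation f |-> f^# is the action of the antiunitary map sending
    (A - z)^-1 mu to (A - z^* )^-1 mu, which is well defined because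
    <(A - z)^-1 mu, (A - w)^-1 mu> is conjugated when z and w are.
    Evaluations are bounded by Cauchy-Schwarz, Phi being injective by cyclicity.

    At an eigenvalue l these identities are obtained by letting z tend to l, so
    it must be known that xi has a limit there.  With e an eigenvector, this
    reduces to (l - v) (A - v)^-1 p -> 0 for every p orthogonal to e.  On the
    range of A - l, which is dense in the orthogonal complement of e, this holds
    as soon as (l - v) (A - v)^-1 stays bounded near l.  That bound is the
    inequality |(A - x)^-1| <= 1 / dist(x, Sp A) at real points x, which holds
    because the norm of a bounded symmetric operator is, up to sign, an
    approximate eigenvalue. *)
Require Import Defs.
From mathcomp Require Import ring lra.

Set Implicit Arguments.
Unset Strict Implicit.

Local Open Scope classical_set_scope.
Local Open Scope ring_scope.

(** * Hilbert spaces *)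

Section HilbertSpace.
Context {R : realType} {H : completeNormedModType R[i]}.
Variable dot : {dot H for @Num.conj R[i]}.
Local Notation "<< x , y >>" := (ip dot x y).

Lemma ipDr (x y z : H) : <<x, y + z>> = <<x, y>> + <<x, z>>.
Proof. exact: linearDl. Qed.

Lemma ipDl (x y z : H) : <<x + y, z>> = <<x, z>> + <<y, z>>.
Proof. exact: linearDr. Qed.

Lemma ipBr (x y z : H) : <<x, y - z>> = <<x, y>> - <<x, z>>.
Proof. exact: linearBl. Qed.

Lemma ipBl (x y z : H) : <<x - y, z>> = <<x, z>> - <<y, z>>.
Proof. exact: linearBr. Qed.

Lemma ipZr (a : R[i]) (x y : H) : <<x, a *: y>> = a * <<x, y>>.
Proof. exact: linearZl_LR. Qed.

Lemma ipZl (a : R[i]) (x y : H) : <<a *: x, y>> = a^* * <<x, y>>.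
Proof. exact: linearZr_LR. Qed.

Lemma ip0r (x : H) : <<x, 0>> = 0.
Proof. exact: linear0l. Qed.

Lemma ip0l (x : H) : <<0, x>> = 0.
Proof. exact: linear0r. Qed.

Lemma ipC (x y : H) : <<x, y>>^* = <<y, x>>.
Proof. by rewrite /ip (hermC dot x y) expr0 mul1r. Qed.

Lemma ip_sumr (x : H) n (c : 'I_n -> R[i]) (v : 'I_n -> H) :
  <<x, \sum_(i < n) c i *: v i>> = \sum_(i < n) c i * <<x, v i>>.
Proof.
elim/big_ind2 : _ => [|a a' b b' <- <-|i _]; first exact: ip0r.
  by rewrite ipDr.
by rewrite ipZr.
Qed.

Hypothesis dotP : inner_product_norm dot.

(** Pythagoras for the multiple of [y] nearest to [x]. Cauchy-Schwarz and the orthogonality of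
    projection residuals both come from this identity. *)
Lemma sqr_norm_projection (x y : H) : y != 0 ->
  `|x - (<<y, x>> / <<y, y>>) *: y| ^+ 2 = `|x| ^+ 2 - `|<<y, x>>| ^+ 2 / `|y| ^+ 2.
Proof.
move=> y0; have yy0 : <<y, y>> != 0 by rewrite -dotP expf_neq0 ?normr_eq0.
have yyJ : <<y, y>>^* = <<y, y>> by rewrite ipC.
have cJ : (<<y, x>> / <<y, y>>)^* = <<x, y>> / <<y, y>>.
  by rewrite rmorphM fmorphV /= ipC yyJ.
by rewrite normCK !dotP ipBl !ipBr !ipZl !ipZr cJ ipC; field.
Qed.

Lemma CauchySchwarz_ip (x y : H) : `|<<x, y>>| <= `|x| * `|y|.
Proof.
have [->|x0] := eqVneq x 0; first by rewrite ip0l !normr0 mul0r.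
have := exprn_ge0 2 (normr_ge0 (y - (<<x, y>> / <<x, x>>) *: x)).
rewrite sqr_norm_projection// subr_ge0 ler_pdivrMr ?exprn_gt0 ?normr_gt0//.
by rewrite -exprMn ler_sqr ?nnegrE ?mulr_ge0// mulrC.
Qed.

Lemma ip_cvgl {T : Type} {F : set_system T} {FF : Filter F} (f : T -> H) (x y : H) :
  f t @[t --> F] --> x -> <<f t, y>> @[t --> F] --> (<<x, y>> : R[i]^o).
Proof.
move=> fx; apply/(@cvgrPdist_lt _ R[i]^o) => e e0.
have y1 : 0 < `|y| + 1 by rewrite ltr_wpDl.
have /cvgrPdist_lt/(_ (e / (`|y| + 1))) := fx.
rewrite divr_gt0// => /(_ isT); apply: filterS => t ht.
rewrite -ipBl; apply: le_lt_trans (CauchySchwarz_ip _ _) _.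
apply: (@le_lt_trans _ _ (`|x - f t| * (`|y| + 1))).
  by rewrite ler_wpM2l// lerDl.
by rewrite -ltr_pdivlMr.
Qed.

Lemma ip_cvgr {T : Type} {F : set_system T} {FF : Filter F} (f : T -> H) (x y : H) :
  f t @[t --> F] --> x -> <<y, f t>> @[t --> F] --> (<<y, x>> : R[i]^o).
Proof.
move=> /(@ip_cvgl _ _ _ _ _ y)/(@cvgrPdist_lt _ R[i]^o) fx.
apply/(@cvgrPdist_lt _ R[i]^o) => e /fx.
by apply: filterS => t; rewrite -(ipC x y) -(ipC (f t) y) -rmorphB norm_conjC.
Qed.

(** [R[i]] is only partially ordered; suprema, infima and order arithmetic are carried out on
    real-valued norms. *)
Definition rnorm (x : H) : R := complex.Re `|x|.

Lemma rnormE (x : H) : `|x| = (rnorm x)%:C%C.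
Proof. by rewrite /rnorm RRe_real// ger0_real. Qed.

Lemma rnorm_ge0 (x : H) : 0 <= rnorm x.
Proof. by rewrite -ler0c -rnormE. Qed.

Lemma rnorm_gt0 (x : H) : (0 < rnorm x) = (x != 0).
Proof. by rewrite -normr_gt0 rnormE ltcR. Qed.

Lemma normc_real (s : R) : `|s%:C%C| = `|s|%:C%C :> R[i].
Proof. by rewrite normc_def /= expr0n addr0 sqrtr_sqr. Qed.

Lemma rnormZ (a : R) (x : H) : rnorm (a%:C%C *: x) = `|a| * rnorm x.
Proof.
by apply: complexI; rewrite -rnormE normrZ rmorphM /= -rnormE normc_real.
Qed.

Lemma ler_rnormB (x y : H) : rnorm (x - y) <= rnorm x + rnorm y.
Proof. by rewrite -lecR rmorphD /= -!rnormE ler_normB. Qed.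

(** * Orthogonal projection and approximate eigenvalues *)

Lemma parallelogram (x y : H) :
  `|x + y| ^+ 2 + `|x - y| ^+ 2 = 2 * (`|x| ^+ 2 + `|y| ^+ 2).
Proof. by rewrite !dotP !ipBl !ipBr !ipDl !ipDr; ring. Qed.

Lemma near_infty_invS_lt (e : R[i]) : 0 < e ->
  \forall n \near \oo, (n.+1%:R^-1 : R[i]) < e.
Proof.
move=> e0; have eE : e = (complex.Re e)%:C%C by rewrite RRe_real ?gtr0_real.
have re0 : 0 < complex.Re e by rewrite -ltcR -eE.
have := near_infty_natSinv_lt (PosNum re0); apply: filterS => n /= h.
by rewrite eE -[n.+1%:R](rmorph_nat (real_complex R)) -fmorphV ltcR.
Qed.

Lemma cvg_cauchy_seq (u : nat -> H) :
  (forall e : R[i], 0 < e -> exists N, forall n, (N <= n)%N -> `|u N - u n| < e) ->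
  cvg (u @ \oo).
Proof.
move=> uc; apply: cauchy_cvg; apply: cauchy_exP => e e0.
have [N uN] := uc _ e0; exists (u N); exists N => // n /= Nn.
by rewrite -ball_normE /=; exact: uN.
Qed.

(** The point nearest to [p] is obtained as a limit of points of the subspace [S]. A minimizing
    sequence is Cauchy by the parallelogram law, and the limiting residual [q] is orthogonal to [S]
    because no correction along [S] can shorten it. *)
Lemma orthogonal_projection (S : set H) (p : H) :
  S 0 -> (forall a x y, S x -> S y -> S (a *: x + y)) ->
  exists (m : nat -> H) (q : H), [/\ forall n, S (m n),
    m @ \oo --> p - q & forall x, S x -> <<x, q>> = 0].
Proof.
move=> S0 SD.
have SZ a x : S x -> S (a *: x) by move=> Sx; rewrite -[_ *: _]addr0; exact: SD.
have SA x y : S x -> S y -> S (x + y) by move=> Sx Sy; rewrite -[x]scale1r; exact: SD.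
pose E := [set rnorm (p - s) ^+ 2 | s in S].
have Einf : has_inf E.
  split; first by exists (rnorm (p - 0) ^+ 2), 0.
  by exists 0 => _ [s _ <-]; rewrite sqr_ge0.
pose d := (inf E)%:C%C.
have dle s : S s -> d <= `|p - s| ^+ 2.
  move=> Ss; rewrite rnormE -rmorphXn lecR; apply: ge_inf; first exact: Einf.2.
  by exists s.
have /choice[m mP] (n : nat) :
    exists s, S s /\ `|p - s| ^+ 2 < d + n.+1%:R^-1.
  have n0 : 0 < (n.+1%:R^-1 : R) by rewrite invr_gt0.
  have [_ [s Ss <-] h] := inf_adherent n0 Einf.
  exists s; split=> //; rewrite rnormE -rmorphXn /d.
  by rewrite -[n.+1%:R](rmorph_nat (real_complex R)) -fmorphV -rmorphD ltcR.
have Sm n := (mP n).1; have mlt n := ltW (mP n).2.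
have half : (2^-1 : R[i]) * 2 = 1 by rewrite mulVf.
(* The midpoint of [m i] and [m j] lies in [S], so its squared distance to [p] is at least [d]; the
   parallelogram law turns this into a bound on [m i - m j]. *)
have mC i j : `|m i - m j| ^+ 2 <= 2 * (i.+1%:R^-1 + j.+1%:R^-1).
  have := parallelogram (p - m i) (p - m j).
  have -> : p - m i - (p - m j) = - (m i - m j).
    by rewrite !opprB addrC addrA subrK.
  have -> : p - m i + (p - m j) = 2 *: (p - 2^-1 *: (m i + m j)).
    by rewrite scalerBr scalerA mulrC half scale1r scaler_nat mulr2n opprD addrACA.
  rewrite normrN normrZ exprMn normr_nat => h.
  have := dle _ (SZ (2^-1) _ (SA _ _ (Sm i) (Sm j))).
  have := mlt i; have := mlt j; move: h.
  set X := `|_ - 2^-1 *: _| ^+ 2; set Y := `|m i - m j| ^+ 2.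
  set Z := `|p - m i| ^+ 2; set W := `|p - m j| ^+ 2 => h Wle Zle Xle.
  have -> : Y = 2 * (Z + W) - 2 ^+ 2 * X by rewrite -h addrC addKr.
  have -> : 2 * (i.+1%:R^-1 + j.+1%:R^-1) =
    2 * (d + i.+1%:R^-1 + (d + j.+1%:R^-1)) - 2 ^+ 2 * d :> R[i] by ring.
  by rewrite lerB// ler_wpM2l// ?lerD// exprn_ge0.
have mcvg : cvg (m @ \oo).
  apply: cvg_cauchy_seq => e e0.
  have e4 : 0 < e ^+ 2 / 4 by rewrite divr_gt0 ?exprn_gt0.
  have [N _ /(_ N (leqnn N)) /= Ne] := near_infty_invS_lt e4.
  exists N => n Nn; rewrite -ltr_sqr ?nnegrE ?(ltW e0)//.
  apply: le_lt_trans (mC _ _) _.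
  apply: (@le_lt_trans _ _ (2 * (N.+1%:R^-1 + N.+1%:R^-1))).
    by rewrite ler_wpM2l// lerD2l lef_pV2 ?posrE// ler_nat.
  move: Ne; rewrite ltr_pdivlMr// => Ne.
  by rewrite (_ : 2 * _ = N.+1%:R^-1 * 4)//; ring.
exists m, (p - lim (m @ \oo)); split=> //; first by rewrite opprB addrCA subrr addr0.
move=> s Ss; have [->|s0] := eqVneq s 0; first by rewrite ip0l.
have sP : 0 < `|s| ^+ 2 by rewrite exprn_gt0 ?normr_gt0.
have cvg1 : << s, p - m n>> @[n --> \oo] --> (<< s, p - lim (m @ \oo)>> : R[i]^o).
  by apply: ip_cvgr; apply: cvgB => //; exact: cvg_cst.
have cvg2 : << s, p - m n>> @[n --> \oo] --> (0 : R[i]^o).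
  apply/(@cvgrPdist_lt _ R[i]^o) => e e0.
  have es : 0 < e ^+ 2 / `|s| ^+ 2 by rewrite divr_gt0 ?exprn_gt0 ?normr_gt0.
  have h := near_infty_invS_lt es; apply: filterS h => n ne.
  rewrite sub0r normrN -ltr_sqr ?nnegrE ?(ltW e0)//.
  move: ne; rewrite ltr_pdivlMr//; apply: le_lt_trans.
  (* Moving [m n] along [s] by the best coefficient lowers the squared distance by |<s, p - m n>|^2
     / |s|^2, yet the result is still at least [d]; the drop is thus at most 1/(n+1). *)
  have := dle _ (SA _ _ (SZ (<< s, p - m n>> / << s, s>>) _ Ss) (Sm n)).
  rewrite opprD [- (_ *: s) - _]addrC addrA sqr_norm_projection// => h.
  rewrite -ler_pdivrMr//.
  have := le_trans h (lerB (mlt n) (lexx _)).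
  by rewrite -addrA lerDl subr_ge0.
exact: (@norm_cvg_unique _ R[i]^o _ _ _ _ cvg1 cvg2).
Qed.

(** [c] is the operator norm of [B]. For a unit vector [y] with b = |B y| close to [c], symmetry
    gives |B^2 y - c^2 y|^2 = |B^2 y|^2 - 2 c^2 b^2 + c^4, and |B^2 y| <= c b bounds this by c^2 (c
    - b) (c + b). The vector [y0] witnesses that [c] exceeds [k]. *)
Lemma symmetric_approx_eigenvalue (B : H -> H) (K k : R) (y0 : H) :
  (forall a x y, B (a *: x + y) = a *: B x + B y) ->
  (forall x y, <<B x, y>> = <<x, B y>>) ->
  (forall x, rnorm (B x) <= K * rnorm x) ->
  0 <= k -> k * rnorm y0 < rnorm (B y0) ->
  exists2 c : R, k < c & forall e : R, 0 < e ->
    exists2 y, rnorm y = 1 & rnorm (B (B y) - (c ^+ 2)%:C%C *: y) < e.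
Proof.
move=> BD Bsym BK k0 ky0.
have B0 : B 0 = 0.
  by have := BD (-1) 0 0; rewrite scaler0 addr0 scaleN1r addNr.
have BZ a x : B (a *: x) = a *: B x by have := BD a x 0; rewrite B0 !addr0.
pose E := [set rnorm (B x) | x in [set x : H | rnorm x = 1]].
have normalize x : x != 0 -> exists2 y, rnorm y = 1 & rnorm (B x) = rnorm x * rnorm (B y).
  move=> x0; have nx : 0 < rnorm x by rewrite rnorm_gt0.
  exists ((rnorm x)^-1%:C%C *: x).
    by rewrite rnormZ gtr0_norm ?invr_gt0// mulVf// gt_eqF.
  by rewrite BZ rnormZ gtr0_norm ?invr_gt0// mulVKf// gt_eqF.
have y0N : y0 != 0.
  by apply: contraTneq ky0 => ->; rewrite B0 /rnorm normr0 mulr0 ltxx.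
have [u u1 uE] := normalize _ y0N.
have Esup : has_sup E.
  split; first by exists (rnorm (B u)), u.
  by exists K => _ [x /= x1 <-]; have := BK x; rewrite x1 mulr1.
pose c := sup E.
have Bc x : rnorm (B x) <= c * rnorm x.
  have [->|x0] := eqVneq x 0; first by rewrite B0 /rnorm normr0 mulr0.
  have [y y1 ->] := normalize _ x0.
  by rewrite mulrC ler_wpM2r ?rnorm_ge0//; apply: sup_upper_bound => //; exists y.
have kc : k < c.
  have := lt_le_trans ky0 (Bc y0).
  by rewrite ltr_pM2r ?rnorm_gt0.
have c0 : 0 < c by exact: le_lt_trans kc.
exists c => // e e0.
(* Since c + b <= 2 c, the squared residual is at most 2 c^3 (c - b). *)
have h0 : 0 < e ^+ 2 / (2 * c ^+ 3) by rewrite divr_gt0 ?mulr_gt0 ?exprn_gt0.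
have [_ [y y1 <-] yc] := sup_adherent h0 Esup; exists y => //.
rewrite -ltr_sqr ?nnegrE ?rnorm_ge0 ?(ltW e0)//.
have -> (t : R) : rnorm (B (B y) - t%:C%C *: y) ^+ 2 =
    rnorm (B (B y)) ^+ 2 - 2 * t * rnorm (B y) ^+ 2 + t * t.
  have sqE x : <<x, x>> = (rnorm x ^+ 2)%:C%C by rewrite rmorphXn /= -rnormE dotP.
  apply: complexI; rewrite -sqE rmorphD rmorphB.
  rewrite (rmorphM _ (2 * t)) (rmorphM _ 2 t) (rmorphM _ t t)  /= -!sqE.
  have tJ : t%:C%C^* = t%:C%C :> R[i] by exact: conjc_real.
  have y1' : <<y, y>> = 1 by rewrite sqE y1 expr1n.
  rewrite ipBl !ipBr !ipZl !ipZr y1'.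
  rewrite -(Bsym y (B y)) -(Bsym (B y) y).
  by rewrite tJ (rmorph_nat (real_complex R) 2); ring.
move: yc; rewrite -/c ltrBlDr -ltrBlDl ltr_pdivlMr ?mulr_gt0 ?exprn_gt0// => yc.
have := Bc (B y); have := Bc y; rewrite y1 mulr1.
have := rnorm_ge0 (B y); have := rnorm_ge0 (B (B y)).
set a := rnorm (B (B y)); set b := rnorm (B y) => a0 b0 bc acb.
have ab : a ^+ 2 <= (c * b) ^+ 2 by rewrite ler_sqr// nnegrE mulr_ge0// ltW.
apply: le_lt_trans yc.
have -> : (c - b) * (2 * c ^+ 3) = c ^+ 2 * ((c - b) * (2 * c)) by ring.
have : c ^+ 2 * ((c - b) * (c + b)) <= c ^+ 2 * ((c - b) * (2 * c)).
  by rewrite ler_pM2l ?exprn_gt0// ler_wpM2l ?subr_ge0//; lra.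
by apply: le_trans; rewrite (_ : c ^+ 2 * _ = c ^+ 4 - (c * b) ^+ 2); nra.
Qed.

End HilbertSpace.

(** * Resolvents *)

Section Resolvent.
Context {R : realType} {H : completeNormedModType R[i]}.
Variable A : unbounded_op H.

Lemma op_dom0 : op_dom A 0.
Proof. by have [/set_mem] := op_dom_submod A. Qed.

Lemma op_domP (a : R[i]) (x y : H) :
  op_dom A x -> op_dom A y -> op_dom A (a *: x + y).
Proof.
by move=> Ax Ay; have [_ /(_ a x y)] := op_dom_submod A; rewrite !inE => /(_ Ax Ay).
Qed.

Lemma op_domZ (a : R[i]) (x : H) : op_dom A x -> op_dom A (a *: x).
Proof. by move=> Ax; rewrite -[_ *: _]addr0; apply: op_domP => //; exact: op_dom0. Qed.

Lemma op_fun0 : A 0 = 0.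
Proof.
by have := op_linear (-1) op_dom0 op_dom0; rewrite scaler0 addr0 scaleN1r addNr.
Qed.

Lemma op_funZ (a : R[i]) (x : H) : op_dom A x -> A (a *: x) = a *: A x.
Proof. by move=> Ax; have := op_linear a Ax op_dom0; rewrite op_fun0 !addr0. Qed.

Section AtPoint.
Variable z : R[i].
Hypothesis rz : resolvent_set A z.

Lemma resolventP (y : H) :
  op_dom A (resolvent A z y) /\ A (resolvent A z y) - z *: resolvent A z y = y.
Proof.
have [[_ _ sz] _] := rz; have [x Ax xy] := sz y I.
by apply: (@xgetPex _ 0 [set x | op_dom A x /\ shifted_op A z x = y]); exists x.
Qed.

Lemma op_dom_resolvent (y : H) : op_dom A (resolvent A z y).
Proof. exact: (resolventP y).1. Qed.

Lemma op_resolvent (y : H) : A (resolvent A z y) = y + z *: resolvent A z y.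
Proof. by rewrite -{2}(resolventP y).2 subrK. Qed.

Lemma resolvent_uniq (x y : H) : op_dom A x -> A x - z *: x = y -> resolvent A z y = x.
Proof.
move=> Ax xy; have [[_ iz _] _] := rz.
apply: iz; rewrite ?inE //; first exact: op_dom_resolvent.
by rewrite /shifted_op xy (resolventP y).2.
Qed.

Lemma resolvent_linear (a : R[i]) (x y : H) :
  resolvent A z (a *: x + y) = a *: resolvent A z x + resolvent A z y.
Proof.
have Rx := op_dom_resolvent x; have Ry := op_dom_resolvent y.
apply: resolvent_uniq; first exact: op_domP.
by rewrite op_linear // !op_resolvent !scalerDr !scalerA [a * z]mulrC addrACA addrK.
Qed.

Lemma resolvent0 : resolvent A z 0 = 0.
Proof.
by apply: resolvent_uniq; [exact: op_dom0|rewrite op_fun0 scaler0 subrr].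
Qed.

Lemma resolventZ (a : R[i]) (x : H) : resolvent A z (a *: x) = a *: resolvent A z x.
Proof. by have := resolvent_linear a x 0; rewrite resolvent0 !addr0. Qed.

Lemma resolventD (x y : H) : resolvent A z (x + y) = resolvent A z x + resolvent A z y.
Proof. by have := resolvent_linear 1 x y; rewrite !scale1r. Qed.

Lemma resolvent_eigen (l : R[i]) (x : H) : op_dom A x -> A x = l *: x -> l != z ->
  resolvent A z x = (l - z)^-1 *: x.
Proof.
move=> Ax xl lz; apply: resolvent_uniq; first exact: op_domZ.
rewrite op_funZ// xl !scalerA -scalerBl -mulrC -mulrBl mulfV ?scale1r//.
by rewrite subr_eq0.
Qed.

(** Continuity at 0 sends some ball of radius [e] into the unit ball; rescaling [y] to norm e/2
    gives the bound 2/e. *)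
Lemma resolvent_bounded : exists2 K : R, 0 < K &
  forall y, rnorm (resolvent A z y) <= K * rnorm y.
Proof.
have [_ /(_ 0)] := rz.
move=> /cvgrPdist_lt/(_ 1 ltr01); rewrite resolvent0 => /nbhs_ballP[e /= e0 he].
have eE : e = (complex.Re e)%:C%C by rewrite RRe_real ?gtr0_real.
have re0 : 0 < complex.Re e by rewrite -ltcR -eE.
exists (2 / complex.Re e); first by rewrite divr_gt0.
move=> y; have [->|y0] := eqVneq y 0; first by rewrite resolvent0 /rnorm normr0 mulr0.
have ny : 0 < rnorm y by rewrite rnorm_gt0.
have := he ((complex.Re e / (2 * rnorm y))%:C%C *: y).
rewrite -ball_normE /= !sub0r !normrN resolventZ !rnormE eE !ltcR !rnormZ.
rewrite gtr0_norm ?divr_gt0 ?mulr_gt0//.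
have -> : complex.Re e / (2 * rnorm y) * rnorm y = complex.Re e / 2.
  by field; rewrite gt_eqF.
rewrite ltr_pdivrMr// ltr_pMr// ltr1n => /(_ isT) /ltW.
rewrite -ler_pdivlMl ?divr_gt0 ?mulr_gt0// => h.
by rewrite (le_trans h)// mulr1 invf_div mulrAC.
Qed.

End AtPoint.

Lemma resolvent_identity (z w : R[i]) (y : H) :
  resolvent_set A z -> resolvent_set A w ->
  resolvent A z y - resolvent A w y = (z - w) *: resolvent A z (resolvent A w y).
Proof.
move=> rz rw; apply/eqP; rewrite subr_eq; apply/eqP.
have dw := op_dom_resolvent rw y.
apply: (resolvent_uniq rz); first exact/op_domP/dw/op_dom_resolvent.
rewrite op_linear //; last exact: op_dom_resolvent.
rewrite !op_resolvent// !scalerDr !scalerA.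
rewrite [z * _]mulrC scalerBl.
move: (_ *: resolvent A z _) (z *: _) (w *: _) => b za wa.
by rewrite [za - wa + b]addrAC addrCA subrK [b + za]addrC addrK.
Qed.

Lemma resolventC (z w : R[i]) (y : H) :
  resolvent_set A z -> resolvent_set A w ->
  resolvent A z (resolvent A w y) = resolvent A w (resolvent A z y).
Proof.
move=> rz rw; have [->//|zw] := eqVneq z w.
have zw0 : z - w != 0 by rewrite subr_eq0.
apply: (scalerI zw0); rewrite -resolvent_identity//.
by rewrite -opprB resolvent_identity// -scaleNr opprB.
Qed.

(** With R(z) = (A - z)^-1 and u = f t, the resolvent identity writes the difference as (z - u) R(z)
    R(u) y, so it is enough that R(u) y stays bounded as u tends to [z]. *)
Lemma cvg_resolvent {T : Type} {F : set_system T} {FF : Filter F} (f : T -> R[i]^o)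
    (z : R[i]^o) (y : H) :
  resolvent_set A z -> f @ F --> z -> (\forall t \near F, resolvent_set A (f t)) ->
  resolvent A (f t) y @[t --> F] --> resolvent A z y.
Proof.
move=> rz /(@cvgrPdist_lt _ R[i]^o) Fz Fr.
have [K K0 RK] := resolvent_bounded rz.
have KC : 0 < K%:C%C :> R[i] by rewrite ltcR.
have RKC x : `|resolvent A z x| <= K%:C%C * `|x| by rewrite !rnormE -rmorphM lecR.
apply/cvgrPdist_lt => e e0.
pose b := 2 * K%:C%C * (`|resolvent A z y| + 1).
have b0 : 0 < b by rewrite !mulr_gt0// ltr_wpDl.
have h1 := Fz (e / b) (divr_gt0 e0 b0).
have h2 : \forall t \near F, `|z - f t| < (2 * K%:C%C)^-1.
  by apply: Fz; rewrite invr_gt0 mulr_gt0.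
near=> t.
have ru : resolvent_set A (f t) by near: t.
rewrite resolvent_identity// normrZ.
set x := resolvent A (f t) y.
(* For |z - u| < 1/(2 K) the same identity gives |x| <= |R(z) y| + |x|/2, and the last term is
   absorbed. *)
have xle : `|x| <= 2 * `|resolvent A z y|.
  have half : `|z - f t| * `|resolvent A z x| <= `|x| / 2.
    have zu : `|z - f t| < (2 * K%:C%C)^-1 by near: t.
    apply: le_trans (ler_pM _ _ (ltW zu) (RKC x)) _ => //.
    by rewrite invfM -mulrA mulKf ?gt_eqF// mulrC.
  suff : `|x| <= `|resolvent A z y| + `|x| / 2.
    rewrite -lerBlDr; rewrite {1}[`|x|]splitr addrK ler_pdivrMr// mulrC.
    exact.
  have xE : x = resolvent A z y - (z - (f t)) *: resolvent A z x.
    by rewrite -resolvent_identity// opprB addrC subrK.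
  by rewrite {1}xE (le_trans (ler_normB _ _))// normrZ lerD2l.
have ub : `|z - f t| < e / b by near: t.
apply: (@le_lt_trans _ _ (`|z - f t| * b)); last by rewrite -ltr_pdivlMr.
rewrite ler_wpM2l// (le_trans (RKC _))// /b [2 * _]mulrC -mulrA ler_pM2l//.
by rewrite (le_trans xle)// ler_pM2l// lerDl.
Unshelve. all: by end_near.
Qed.

End Resolvent.

(** * Self-adjoint operators near an isolated eigenvalue *)

Lemma near_dnbhs_dist {R : realType} (z : R[i]^o) (d : R[i]) : 0 < d ->
  \forall v \near z^', v != z /\ `|v - z| < d.
Proof.
move=> d0; apply: filterS (dnbhs_ball z d0) => v [].
by rewrite -ball_normE /= distrC => ? /eqP ?.
Qed.

Section SelfAdjoint.
Context {R : realType} {H : completeNormedModType R[i]}.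
Variables (dot : {dot H for @Num.conj R[i]}) (A : unbounded_op H).
Local Notation "<< x , y >>" := (ip dot x y).
Hypothesis dotP : inner_product_norm dot.
Hypothesis A_sa : self_adjoint dot A.

Lemma op_symmetric (x y : H) : op_dom A x -> op_dom A y -> <<A x, y>> = <<x, A y>>.
Proof.
move=> Ax Ay; have : op_graph A (x, A x) by [].
by rewrite -(A_sa.2) => /(_ y Ay).
Qed.

Lemma op_adjoint (x y : H) : (forall u, op_dom A u -> <<y, u>> = <<x, A u>>) ->
  op_dom A x /\ A x = y.
Proof.
move=> xy; have : adjoint_graph dot A (x, y) by [].
by rewrite A_sa.2 => -[/= Ax ->].
Qed.

Lemma eigenvalue_real (l : R[i]) (x : H) :
  op_dom A x -> A x = l *: x -> x != 0 -> l \is Num.real.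
Proof.
move=> Ax xl x0; have := op_symmetric Ax Ax; rewrite xl ipZl ipZr.
have xx0 : <<x, x>> != 0 by rewrite -dotP expf_neq0 ?normr_eq0.
by move/(mulIf xx0)/CrealP.
Qed.

Lemma resolvent_adjoint (z : R[i]) (x y : H) : resolvent_set A z -> resolvent_set A z^* ->
  <<resolvent A z x, y>> = <<x, resolvent A z^* y>>.
Proof.
move=> rz rzJ.
rewrite -{1}(resolventP rzJ y).2 -{2}(resolventP rz x).2 ipBr ipBl ipZr ipZl.
by rewrite op_symmetric//; exact: op_dom_resolvent.
Qed.

(* If the inequality fails, the norm c of B = (A - x)^-1 exceeds 1/d, so that
   x + 1/c and x - 1/c lie in the resolvent set.  Hence B - c and B + c are both
   bounded below, and so is B^2 - c^2, although c^2 is an approximate eigenvalue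
   of B^2. *)
Lemma resolvent_gap (x d : R) (y : H) : 0 < d ->
  (forall t : R, `|t - x| < d -> resolvent_set A t%:C%C) ->
  op_dom A y -> d * rnorm y <= rnorm (A y - x%:C%C *: y).
Proof.
move=> d0 rt Ay; rewrite leNgt; apply/negP => yd.
have rx : resolvent_set A x%:C%C by apply: rt; rewrite subrr normr0.
have xJ : (x%:C%C)^* = x%:C%C :> R[i] by exact: conjc_real.
pose B := resolvent A x%:C%C.
have [K _ BK] := resolvent_bounded rx.
have Bsym u v : <<B u, v>> = <<u, B v>>.
  by rewrite /B resolvent_adjoint ?xJ.
have By : B (A y - x%:C%C *: y) = y by exact: resolvent_uniq.
have [||c dc Bc] := symmetric_approx_eigenvalue dotP (y0 := A y - x%:C%C *: y)
    (resolvent_linear rx) Bsym BK (k := d^-1).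
- by rewrite invr_ge0 ltW.
- by rewrite -/B By mulrC ltr_pdivrMr// mulrC.
have c0 : 0 < c by apply: lt_trans dc; rewrite invr_gt0.
have cd : c^-1 < d by rewrite -[d]invrK ltf_pV2 ?posrE ?invr_gt0.
have bound s : s ^+ 2 = 1 -> exists2 M, 0 < M &
    forall v, rnorm v <= M * rnorm (B v - (s * c)%:C%C *: v).
  move=> s2; have s1 : `|s| = 1 by apply/eqP; rewrite -sqr_norm_eq1 s2.
  have s0 : s != 0 by rewrite -normr_eq0 s1 oner_eq0.
  have sc0 : s * c != 0 by rewrite mulf_neq0// gt_eqF.
  have sc1 : (s * c)%:C%C^-1 = (s * c)^-1%:C%C :> R[i] by rewrite fmorphV.
  have scN : `|(s * c)^-1| = c^-1 by rewrite normfV normrM s1 mul1r gtr0_norm.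
  pose t := x + (s * c)^-1.
  have rt' : resolvent_set A t%:C%C by apply: rt; rewrite addrC addKr scN.
  have [L L0 RL] := resolvent_bounded rt'.
  exists (c^-1 * (L * c^-1 + 1)) => [|v].
    by rewrite mulr_gt0 ?invr_gt0// addr_gt0// mulr_gt0// invr_gt0.
  set w := B v - _.
  have vE : v = (s * c)^-1%:C%C *: (B v - w).
    by rewrite /w subKr scalerA -sc1 mulVf ?scale1r// fmorph_eq0.
  (* From (A - x) B v = v and v = (B v - w) / (s c) follows (A - t) B v = - w / (s c), so the
     resolvent at [t] bounds [B v], and then [v], in terms of [w]. *)
  have BvE : B v = resolvent A t%:C%C (- ((s * c)^-1%:C%C *: w)).
    apply/esym; apply: resolvent_uniq => //; first exact: op_dom_resolvent.
    rewrite (op_resolvent rx v) -/B {1}vE scalerBr /t rmorphD scalerDl /=.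
    move: (_ *: w) (_ *: B v) (_ *: B v) => b a p.
    by rewrite [p - b + a]addrAC [a + p]addrC [_ - (p + a)]addrAC subrr add0r.
  rewrite {1}vE rnormZ scN -mulrA ler_pM2l ?invr_gt0// (le_trans (ler_rnormB _ _))//.
  rewrite mulrDl mul1r lerD2r BvE (le_trans (RL _))//.
  by rewrite /rnorm normrN -/(rnorm _) rnormZ scN mulrA.
have [M1 M10 b1] := bound 1 (expr1n _ _).
have [M2 M20 b2] := bound (-1) (sqrr_sign _ 1).
have e0 : 0 < (M1 * M2)^-1 by rewrite invr_gt0 mulr_gt0.
have [v v1] := Bc _ e0.
have -> : B (B v) - (c ^+ 2)%:C%C *: v =
  B (B v - (1 * c)%:C%C *: v) - (-1 * c)%:C%C *: (B v - (1 * c)%:C%C *: v).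
  have -> : B (B v - (1 * c)%:C%C *: v) = B (B v) - c%:C%C *: B v.
    by rewrite mul1r ![_ - _]addrC -!scaleNr /B resolvent_linear.
  rewrite mulN1r mul1r rmorphN /= scaleNr opprK scalerBr scalerA -rmorphM -expr2.
  by rewrite addrA subrK.
have := b1 v; have := b2 (B v - (1 * c)%:C%C *: v).
rewrite v1; set X := rnorm _; set Y := rnorm _ => XY X1; apply/negP; rewrite -leNgt.
rewrite -[leLHS]mul1r ler_pdivrMr ?mulr_gt0//.
by rewrite (le_trans X1)// [M1 * M2]mulrC mulrA mulrC ler_pM2r// mulrC.
Qed.

(** By symmetry <y, (A - a) y> is real, so the cross terms with the imaginary shift cancel. *)
Lemma sqr_norm_shifted_op (a b : R) (y : H) : op_dom A y ->
  `|A y - (a%:C%C + 'i * b%:C%C) *: y| ^+ 2 =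
  `|A y - a%:C%C *: y| ^+ 2 + (b%:C%C * `|y|) ^+ 2.
Proof.
move=> Ay; have aJ : (a%:C%C)^* = a%:C%C :> R[i] by exact: conjc_real.
have bJ : (b%:C%C)^* = b%:C%C :> R[i] by exact: conjc_real.
rewrite exprMn !dotP !ipBl !ipBr !ipZl !ipZr !rmorphD !rmorphM /= conjCi aJ bJ.
rewrite (op_symmetric Ay Ay).
have i2 : 'i * 'i = -1 :> R[i] by rewrite -expr2 sqrCi.
by ring: i2.
Qed.

(** Write v = a + i b. The imaginary part contributes exactly b^2 |y|^2. The real part is bounded by
    [resolvent_gap] at [a] with d = |a - l|: the open interval of radius d around [a] misses [l] and
    stays within distance 2 d < r of it. *)
Lemma isolated_lower_bound (l : R) (r v : R[i]) (y : H) :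
  (forall u : R[i], u != l%:C%C -> `|u - l%:C%C| < r -> resolvent_set A u) ->
  `|v - l%:C%C| < r / 2 -> op_dom A y -> `|v - l%:C%C| * `|y| <= `|A y - v *: y|.
Proof.
move=> rl vl Ay.
have vE : v = (complex.Re v)%:C%C + 'i * (complex.Im v)%:C%C.
  by rewrite -complexiE -complexE.
move: vE vl; set a := complex.Re v; set b := complex.Im v => vE vl.
rewrite -ler_sqr ?nnegrE ?mulr_ge0// {2}vE sqr_norm_shifted_op// exprMn.
have -> : `|v - l%:C%C| ^+ 2 = ((a - l)%:C%C) ^+ 2 + b%:C%C ^+ 2.
  by rewrite -add_Re2_Im2 raddfB /= raddfB /= subr0 rmorphD !rmorphXn.
rewrite mulrDl -!exprMn lerD2r.
have [->|al] := eqVneq a l; first by rewrite subrr mul0r expr0n exprn_ge0.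
have al0 : 0 < `|a - l| by rewrite normr_gt0 subr_eq0.
rewrite !rnormE -rmorphM -!rmorphXn lecR -real_normK ?num_real// normrM.
rewrite (ger0_norm (rnorm_ge0 y)) ler_sqr ?nnegrE ?mulr_ge0 ?rnorm_ge0//.
apply: resolvent_gap => // t ta; apply: rl.
  apply: contraTneq ta => /complexI ->.
  by rewrite -leNgt distrC.
have alv : `|a - l|%:C%C <= `|v - l%:C%C|.
  by rewrite (_ : a - l = complex.Re (v - l%:C%C)) ?normc_ge_Re// raddfB.
have tl : `|t - l| <= `|a - l| + `|a - l|.
  rewrite -[t](subrK a) -addrA (le_trans (ler_normD _ _))// lerD2r ltW//.
rewrite -rmorphB normc_real; apply: (@le_lt_trans _ _ (`|v - l%:C%C| * 2)).
  rewrite mulr_natr mulr2n; apply: le_trans (lerD alv alv).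
  by rewrite -rmorphD lecR.
by rewrite -ltr_pdivlMr.
Qed.

(** * The resolvent near an isolated simple eigenvalue *)

Section Eigenvalue.
Variables (l : R) (e : H).
Hypothesis Ae : op_dom A e.
Hypothesis el : A e = l%:C%C *: e.
Hypothesis e0 : e != 0.
Hypothesis e_simple : forall x, op_dom A x -> A x = l%:C%C *: x ->
  exists c : R[i], x = c *: e.

(** Let [q] be the component of [p] orthogonal to the range of A - l. By self-adjointness it lies in
    the kernel of A - l, hence is a multiple of [e] by simplicity. Since [e] is orthogonal to [p]
    and to the range, it is also orthogonal to [q], so q = 0. *)
Lemma range_dense_eigen_ortho (p : H) : <<e, p>> = 0 ->
  exists2 y : nat -> H, forall n, op_dom A (y n) &
    A (y n) - l%:C%C *: y n @[n --> \oo] --> p.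
Proof.
move=> ep; have lJ : (l%:C%C)^* = l%:C%C :> R[i] by exact: conjc_real.
pose S := [set A y - l%:C%C *: y | y in op_dom A].
have [|a _ _ [x Ax <-] [y Ay <-]|m [q [Sm mp qS]]] :=
    orthogonal_projection dotP p (S := S).
- by exists 0; [exact: op_dom0|rewrite op_fun0 scaler0 subr0].
- exists (a *: x + y); first exact: op_domP.
  by rewrite op_linear// scalerBr scalerDr !scalerA opprD addrACA [a * _]mulrC.
have [Aq ql] : op_dom A q /\ A q = l%:C%C *: q.
  apply: op_adjoint => u Au; apply/eqP.
  rewrite ipZl lJ eq_sym -subr_eq0 -ipZr -ipBr -(ipC _ (_ - _)) qS ?conjC0//.
  by exists u.
have [c qc] := e_simple Aq ql.
have em n : <<e, m n>> = 0.
  have [y Ay <-] := Sm n.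
  by rewrite ipBr ipZr -op_symmetric// el ipZl lJ subrr.
have : <<e, p - q>> = 0.
  have h1 : <<e, m n>> @[n --> \oo] --> (<<e, p - q>> : R[i]^o) by exact: ip_cvgr.
  have h2 : <<e, m n>> @[n --> \oo] --> (0 : R[i]^o).
    apply/(@cvgrPdist_lt _ R[i]^o) => d d0; apply: nearW => n.
    by rewrite em subrr normr0.
  exact: (@norm_cvg_unique _ R[i]^o _ _ _ _ h1 h2).
rewrite ipBr ep sub0r => /eqP; rewrite oppr_eq0 qc ipZr mulf_eq0.
rewrite -(dotP e) expf_eq0 /= normr_eq0 (negPf e0) orbF => /eqP c0.
have /choice[y yP] n : exists x, op_dom A x /\ A x - l%:C%C *: x = m n.
  by have [x Ax <-] := Sm n; exists x.
exists y => [n|]; first by case: (yP n).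
have : m = (fun n => A (y n) - l%:C%C *: y n) by apply/funext => n; case: (yP n).
by move: mp; rewrite qc c0 scale0r subr0 => + <-.
Qed.

Hypothesis l_isolated : isolated (spectrum A) (l%:C%C : R[i]^o).

Lemma isolated_radius : exists2 r : R[i], 0 < r &
  forall u : R[i], u != l%:C%C -> `|u - l%:C%C| < r -> resolvent_set A u.
Proof.
have [_ [V /nbhs_ballP[r /= r0 rV] VS]] := l_isolated.
exists r => // u ul ulr; apply: contrapT => su.
have : (V `&` spectrum A) u.
  by split=> //; apply: rV; rewrite -ball_normE /= distrC.
by rewrite VS => /= ule; rewrite ule eqxx in ul.
Qed.

Lemma near_dnbhs_resolvent_set :
  \forall u \near (l%:C%C : R[i]^o)^', resolvent_set A u.
Proof.
have [r r0 rl] := isolated_radius; apply: filterS (near_dnbhs_dist _ r0) => u [].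
exact: rl.
Qed.

Lemma cvg_resolvent_eigen_ortho (p : H) : <<e, p>> = 0 ->
  (l%:C%C - v) *: resolvent A v p @[v --> (l%:C%C : R[i]^o)^'] --> (0 : H).
Proof.
move=> ep; have [y Ay yp] := range_dense_eigen_ortho ep.
have [r r0 rl] := isolated_radius.
apply/cvgrPdist_lt => d d0.
have d2 : 0 < d / 2 by rewrite divr_gt0.
move/cvgrPdist_lt/(_ _ d2) : yp => [n _ /(_ n (leqnn n)) /= pn].
have d4 : 0 < d / 2 / (2 * (`|y n| + 1)) by rewrite !divr_gt0// mulr_gt0// ltr_wpDl.
have r2 : 0 < r / 2 by rewrite divr_gt0.
near=> v.
have [vl vr] : v != l%:C%C /\ `|v - l%:C%C| < r / 2 by near: v; exact: near_dnbhs_dist.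
have rv : resolvent_set A v.
  apply: rl => //; apply: lt_trans vr _.
  by rewrite ltr_pdivrMr// ltr_pMr// ltr1n.
have T1 x : `|(v - l%:C%C) *: resolvent A v x| <= `|x|.
  rewrite normrZ -{2}(resolventP rv x).2.
  by apply: isolated_lower_bound vr _ => //; exact: op_dom_resolvent.
rewrite sub0r normrN -opprB scaleNr normrN.
(* [p] is approximated by (A - l) y with y = y n. As R(v) (A - l) y = y + (v - l) R(v) y, the second
   summand has norm at most 2 |v - l| |y|, while [T1] bounds the first by the approximation
   error. *)
have -> : (v - l%:C%C) *: resolvent A v p =
  (v - l%:C%C) *: resolvent A v (p - (A (y n) - l%:C%C *: y n)) +
  (v - l%:C%C) *: (y n + (v - l%:C%C) *: resolvent A v (y n)).
  rewrite -scalerDr; congr (_ *: _).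
  rewrite -{1}[p](subrK (A (y n) - l%:C%C *: y n)).
  rewrite (resolventD rv (p - _) (_ - _)); congr (_ + _).
  apply: resolvent_uniq => //.
    by rewrite addrC; apply: op_domP => //; exact: op_dom_resolvent.
  rewrite [y n + _]addrC op_linear//; last exact: op_dom_resolvent.
  rewrite op_resolvent// !scalerDr !scalerA [v * _]mulrC scalerBl.
  move: (v *: y n) (l%:C%C *: y n) (_ *: resolvent _ _ _) (A (y n)) => b c q a.
  rewrite [b - c + q]addrAC [q + b]addrC -[_ - c + a]addrA.
  by rewrite [_ - (b + q)]addrAC subrr add0r addrC.
apply: le_lt_trans (ler_normD _ _) _; rewrite (splitr d).
apply: ltr_leD; first exact: le_lt_trans (T1 _) pn.
have v2 : `|v - l%:C%C| < d / 2 / (2 * (`|y n| + 1)).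
  by have [] : v != l%:C%C /\ `|v - l%:C%C| < d / 2 / (2 * (`|y n| + 1));
    first by near: v; exact: near_dnbhs_dist.
move: v2; rewrite ltr_pdivlMr ?mulr_gt0 ?ltr_wpDl// => /ltW; apply: le_trans.
rewrite normrZ ler_wpM2l// (le_trans (ler_normD _ _))//.
rewrite mulr_natl mulr2n lerD// ?(le_trans (T1 _))// ?lerDl//.
Unshelve. all: by end_near.
Qed.

(** The limit is the spectral projection onto the line of [e]: the operator is the identity on [e]
    and tends to 0 on its orthogonal complement. *)
Lemma cvg_resolvent_eigen (x : H) :
  (l%:C%C - v) *: resolvent A v x @[v --> (l%:C%C : R[i]^o)^'] -->
    (<<e, x>> / <<e, e>>) *: e.
Proof.
have ee0 : <<e, e>> != 0 by rewrite -dotP expf_neq0 ?normr_eq0.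
pose p := x - (<<e, x>> / <<e, e>>) *: e.
have ep : <<e, p>> = 0 by rewrite ipBr ipZr divfK// subrr.
have := cvg_resolvent_eigen_ortho ep.
move/(cvgD (@cvg_cst H ((<<e, x>> / <<e, e>>) *: e) _ (l%:C%C : R[i]^o)^' _)).
rewrite addr0; apply: cvg_trans; apply: near_eq_cvg.
near=> v.
have [vl _] : v != l%:C%C /\ `|v - l%:C%C| < 1 by near: v; exact: near_dnbhs_dist.
have rv : resolvent_set A v by near: v; exact: near_dnbhs_resolvent_set.
rewrite /= -{2}[x](subrK ((<<e, x>> / <<e, e>>) *: e)) -/p addrC.
rewrite resolventD// resolventZ// (resolvent_eigen rv Ae el) 1?eq_sym// scalerDr.
by rewrite !scalerA mulrAC mulfV ?mul1r// subr_eq0 eq_sym.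
Unshelve. all: by end_near.
Qed.

End Eigenvalue.

End SelfAdjoint.

(** * The functional model *)

Section FunctionalModel.
Context {R : realType} {H : completeNormedModType R[i]}.
Variables (dot : {dot H for @Num.conj R[i]}) (A : unbounded_op H) (mu : H).
Local Notation "<< x , y >>" := (ip dot x y).
Hypothesis dotP : inner_product_norm dot.
Hypothesis A_sa : self_adjoint dot A.
Hypothesis A_disc : discrete_simple_spectrum A.
Hypothesis mu_cyclic : cyclic_vector A mu.
Hypothesis mu0 : mu != 0.

(** * Real spectrum, cyclicity and the zeros of [weylF] *)

Lemma spectrum_real (z : R[i]) : spectrum A z -> z \is Num.real.
Proof. by case/A_disc => _ [x [Ax x0 xz _]]; exact: eigenvalue_real Ax xz x0. Qed.

Lemma nonreal_resolvent_set (z : R[i]) : z \isn't Num.real -> resolvent_set A z.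
Proof. by move=> zr; apply: contrapT => /spectrum_real; apply/negP. Qed.

Lemma resolvent_set_conj (z : R[i]) : resolvent_set A z -> resolvent_set A z^*.
Proof.
move=> rz; have [/CrealP->//|zr] := boolP (z \is Num.real).
apply: nonreal_resolvent_set; apply: contra zr => /CrealP.
by rewrite conjCK => zJ; apply/CrealP.
Qed.

(** If [x] were nonzero, a combination y of the R(z) mu at distance less than |x| from [x] would
    satisfy |x|^2 = <x - y, x> <= |x - y| |x| < |x|^2. *)
Lemma cyclic_ortho (x : H) :
  (forall z, resolvent_set A z -> <<resolvent A z mu, x>> = 0) -> x = 0.
Proof.
move=> Rx; apply/eqP; apply: contrapT => /negP x0.
have nx : 0 < `|x| by rewrite normr_gt0.
have [|y []] := mu_cyclic (O := ball x `|x|) _ (ball_open x _).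
  by exists x; exact: ballxx.
rewrite -ball_normE /= => xy [n [c [v [vR yE]]]].
have yx : <<y, x>> = 0.
  rewrite yE; elim/big_ind : _ => [|a b a0 b0|i _]; first exact: ip0l.
    by rewrite ipDl a0 b0 addr0.
  by have [z rz <-] := vR i; rewrite ipZl Rx// mulr0.
have := CauchySchwarz_ip dotP (x - y) x.
rewrite ipBl yx subr0 -dotP normrX normr_id expr2 ler_pM2r// => xxy.
by have := le_lt_trans xxy xy; rewrite ltxx.
Qed.

(** Resolvents act on [e] by scalars, so an eigenvector orthogonal to [mu] would be orthogonal to
    every R(z) mu and vanish by cyclicity. *)
Lemma cyclic_eigen (l : R[i]) (e : H) : op_dom A e -> A e = l *: e -> e != 0 ->
  <<mu, e>> != 0.
Proof.
move=> Ae el e0; apply: contraNneq e0 => me; apply/eqP; apply: cyclic_ortho => z rz.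
have rzJ := resolvent_set_conj rz; rewrite (resolvent_adjoint A_sa)//.
have [lz|lz] := eqVneq l z^*; last by rewrite (resolvent_eigen rzJ Ae el)// ipZr me mulr0.
(* Here [e] lies in the kernel of A - l, which is trivial because l = z^* is in the resolvent
   set. *)
rewrite (_ : e = 0) ?resolvent0 ?ip0r// -(resolvent0 rzJ); apply/esym.
by apply: resolvent_uniq; rewrite // el lz subrr.
Qed.

Lemma weylF_conj (z : R[i]) : resolvent_set A z ->
  (weylF dot A mu z^*)^* = weylF dot A mu z.
Proof.
move=> rz; rewrite /weylF ipC (resolvent_adjoint A_sa) ?conjCK//.
exact: resolvent_set_conj.
Qed.

(** With y = R(z) mu and F = [weylF], symmetry gives F(z) - conj F(z) = (z - conj z) |y|^2, and [y]
    is nonzero because [mu] is. *)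
Lemma weylF_nonreal (z : R[i]) : z \isn't Num.real -> weylF dot A mu z != 0.
Proof.
move=> zr; have rz := nonreal_resolvent_set zr; apply: contraNneq zr.
rewrite /weylF; set y := resolvent A z mu => mr.
have rE : A y - z *: y = mu := (resolventP rz mu).2.
have Ar : op_dom A y := op_dom_resolvent rz mu.
have r0 : <<y, y>> != 0.
  rewrite -dotP expf_neq0 ?normr_eq0//; apply: contraNneq mu0 => r0.
  by rewrite -rE r0 op_fun0 scaler0 subr0.
have : <<mu, y>> - <<mu, y>>^* = 0 by rewrite mr conjC0 subrr.
rewrite ipC -rE ipBl ipBr ipZl ipZr (op_symmetric A_sa)//.
rewrite opprB addrCA [_ - _ - _]addrAC subrr add0r -mulrBl => /eqP.
rewrite mulf_eq0 (negPf r0) orbF.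
by rewrite subr_eq0 => /eqP zz; apply/CrealP.
Qed.

(** * Limits of [xi] and [Phi] at eigenvalues and at non-real points *)

Lemma cvg_conj_dnbhs (z : R[i]^o) : (u : R[i]^o)^* @[u --> z^'] --> (z^* : R[i]^o)^'.
Proof.
move=> P /= [e /= e0 eP]; exists e => //= u; rewrite /ball_ /= => zu uz.
apply: eP; rewrite /ball_ /=; first by rewrite -rmorphB norm_conjC.
by apply: contra uz => /eqP/(can_inj conjCK)/eqP.
Qed.

(** Multiplying numerator and denominator of [xi_formula] by l - u^* gives T u / <mu, T u>. Here T u
    tends to the spectral projection [L] of [mu], and cyclicity keeps <mu, L> nonzero. So the [lim]
    in [xi] is an actual limit, not a default value. *)
Lemma cvg_xi (l : R[i]^o) : spectrum A l ->
  xi_formula dot A mu u @[u --> l^'] --> xi dot A mu l.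
Proof.
move=> sl; have [il [e [Ae e0 el e1]]] := A_disc sl.
have lr := spectrum_real sl; have lE : l = (complex.Re l)%:C%C by rewrite RRe_real.
have lJ : l^* = l by exact/CrealP.
rewrite lE in el e1 il.
have cT := cvg_resolvent_eigen dotP A_sa Ae el e0 e1 il (x := mu).
rewrite -lE in cT el e1 il.
set L := _ *: e in cT.
pose T u := (l - u^*) *: resolvent A u^* mu.
have {}cT : T u @[u --> l^'] --> L.
  by apply: cvg_comp cT; rewrite -{2}lJ; exact: cvg_conj_dnbhs.
have cS : (<<mu, T u>> : R[i]^o) @[u --> l^'] --> (<<mu, L>> : R[i]^o).
  exact: ip_cvgr.
have L0 : <<mu, L>> != 0.
  have me := cyclic_eigen Ae el e0.
  by rewrite ipZr !mulf_neq0// ?invr_eq0 -?dotP ?expf_neq0 ?normr_eq0// -ipC conjC_eq0.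
have cX : xi_formula dot A mu u @[u --> l^'] --> <<mu, L>>^-1 *: L.
  have h : <<mu, T u>>^-1 *: T u @[u --> l^'] --> <<mu, L>>^-1 *: L.
    by apply: cvgZ cT; exact: cvgV.
  apply: cvg_trans h; apply: near_eq_cvg.
  near=> u.
  have ul : l - u^* != 0.
    rewrite subr_eq0 -lJ (inj_eq (can_inj conjCK)) eq_sym.
    near: u; exact: nbhs_dnbhs_neq.
  rewrite /xi_formula /T /= ipZr -/(weylF _ _ _ _) scalerA invfM mulrAC mulVf//.
  by rewrite mul1r.
rewrite /xi mem_set//; exact: cvgP cX.
Unshelve. all: by end_near.
Qed.

Lemma near_dnbhs_spectrum (l : R[i]^o) : spectrum A l ->
  \forall u \near l^', resolvent_set A u.
Proof.
move=> sl; have [il _] := A_disc sl.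
have lE : l = (complex.Re l)%:C%C by rewrite RRe_real// spectrum_real.
by move: il; rewrite lE; exact: near_dnbhs_resolvent_set.
Qed.

(** At a zero of [weylF] both sides are 0, since 0^-1 = 0; the formula thus holds on the whole
    resolvent set. *)
Lemma Phi_resolvent (phi : H) (z : R[i]) : resolvent_set A z ->
  Phi dot A mu phi z = (weylF dot A mu z)^-1 * <<mu, resolvent A z phi>>.
Proof.
move=> rz; rewrite /Phi /xi memNset; last by move=> /(_ rz).
rewrite /xi_formula ipZl fmorphV /= weylF_conj// (resolvent_adjoint A_sa) ?conjCK//.
exact: resolvent_set_conj.
Qed.

Lemma cvg_Phi_spectrum (phi : H) (l : R[i]^o) : spectrum A l ->
  Phi dot A mu phi u @[u --> l^'] --> Phi dot A mu phi l.
Proof.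
move=> sl.
have h : (<<xi_formula dot A mu u, phi>> : R[i]^o) @[u --> l^'] -->
    (<<xi dot A mu l, phi>> : R[i]^o) by apply: ip_cvgl => //; exact: cvg_xi.
apply: cvg_trans h; apply: near_eq_cvg; near=> u.
have ru : resolvent_set A u by near: u; exact: near_dnbhs_spectrum.
by rewrite /Phi /xi memNset// => /(_ ru).
Unshelve. all: by end_near.
Qed.

Lemma near_nonreal (w : R[i]^o) : w \isn't Num.real ->
  \forall u \near w^', (u : R[i]) \isn't Num.real.
Proof.
(* Half of |w - w^*| is the distance from [w] to the real axis. *)
move=> wr; have d0 : 0 < `|w - w^*| / 2.
  rewrite divr_gt0// normr_gt0 subr_eq0 eq_sym.
  by apply: contra wr => /eqP/CrealP.
apply: filterS (near_dnbhs_dist w d0) => u [_]; apply: contraTN => /CrealP uJ.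
rewrite -real_leNgt ?realM ?normr_real ?realV ?realn// ler_pdivrMr// mulr_natr mulr2n.
have -> : w - w^* = (u - w)^* - (u - w) by rewrite rmorphB /= uJ; ring.
by rewrite (le_trans (ler_normB _ _))// norm_conjC.
Qed.

(** This identifies the limit by which [swap_zero] is defined at [w]. *)
Lemma cvg_Phi_nonreal (phi : H) (w : R[i]^o) : w \isn't Num.real ->
  Phi dot A mu phi u @[u --> w^'] --> Phi dot A mu phi w.
Proof.
move=> wr; have rw := nonreal_resolvent_set wr.
rewrite Phi_resolvent//.
have nr : \forall u \near w^', (u : R[i]) \isn't Num.real.
  exact: near_nonreal.
have ww : (u : R[i]^o) @[u --> w^'] --> w by exact: nbhs_dnbhs.
have rnear : \forall u \near w^', resolvent_set A u.
  by apply: filterS nr => u; exact: nonreal_resolvent_set.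
have cR x : resolvent A u x @[u --> w^'] --> resolvent A w x by exact: cvg_resolvent.
have cF : (weylF dot A mu u : R[i]^o) @[u --> w^'] --> (weylF dot A mu w : R[i]^o).
  exact: ip_cvgr.
have cI : (<<mu, resolvent A u phi>> : R[i]^o) @[u --> w^'] -->
    (<<mu, resolvent A w phi>> : R[i]^o).
  exact: ip_cvgr.
have h : ((weylF dot A mu u)^-1 * <<mu, resolvent A u phi>> : R[i]^o) @[u --> w^'] -->
    ((weylF dot A mu w)^-1 * <<mu, resolvent A w phi>> : R[i]^o).
  by apply: cvgM cI; apply: cvgV => //; exact: weylF_nonreal.
apply: cvg_trans h; apply: near_eq_cvg; near=> u.
by rewrite Phi_resolvent//; near: u.
Unshelve. all: by end_near.
Qed.


(** * Injectivity of [Phi] and the antiunitary conjugation *)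

Lemma spectrum_infty_real (z : R[i]^o) : spectrum_infty dot A mu z -> (z : R[i])^* = z.
Proof. by case=> /CrealP. Qed.

Lemma nonreal_spectrum_infty (z : R[i]^o) :
  (z : R[i]) \isn't Num.real -> ~ spectrum_infty dot A mu z.
Proof. by move=> zr [/(negP zr)]. Qed.

(** [weylF] has no non-real zeros, so [phi] is orthogonal to R(z) mu for every non-real z. Real
    points of the resolvent set are reached along z + i/(n+1), and cyclicity concludes. *)
Lemma Phi_inj (phi : H) :
  (forall z, ~ spectrum_infty dot A mu z -> Phi dot A mu phi z = 0) -> phi = 0.
Proof.
move=> Phi0; have nr z : z \isn't Num.real -> <<resolvent A z mu, phi>> = 0.
  move=> zr; have zJr : z^* \isn't Num.real.
    by apply: contra zr => /CrealP; rewrite conjCK => zJ; apply/CrealP.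
  have := Phi0 _ (nonreal_spectrum_infty zJr).
  rewrite Phi_resolvent; last exact: nonreal_resolvent_set.
  move/(congr1 (fun a : R[i] => weylF dot A mu z^* * a)).
  rewrite mulVKf ?weylF_nonreal// mulr0.
  by rewrite (resolvent_adjoint A_sa) //; exact: nonreal_resolvent_set.
apply: cyclic_ortho => z rz; have [zr|/nr//] := boolP (z \is Num.real).
pose u (n : nat) : R[i]^o := z + 'i * n.+1%:R^-1.
have un n : u n \isn't Num.real.
  apply/negP => unr; have := rpredB unr zr; rewrite /u addrC addKr.
  move=> /CrealP; rewrite rmorphM /= conjCi fmorphV /= conjC_nat mulNr => /eqP.
  by rewrite eqNr mulf_eq0 invr_eq0 pnatr_eq0 orbF (negPf (neq0Ci _)).
have uz : u @ \oo --> (z : R[i]^o).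
  apply/(@cvgrPdist_lt _ R[i]^o) => d d0; apply: filterS (near_infty_invS_lt d0) => n.
  by rewrite /u opprD addNKr normrN normrM normCi mul1r ger0_norm ?invr_ge0.
have cR : resolvent A (u n) mu @[n --> \oo] --> resolvent A z mu.
  apply: cvg_resolvent => //.
  by apply: nearW => n; exact/nonreal_resolvent_set/un.
have h1 : (<<resolvent A (u n) mu, phi>> : R[i]^o) @[n --> \oo] -->
   (<<resolvent A z mu, phi>> : R[i]^o) by exact: ip_cvgl.
have h2 : (<<resolvent A (u n) mu, phi>> : R[i]^o) @[n --> \oo] --> (0 : R[i]^o).
  apply/(@cvgrPdist_lt _ R[i]^o) => d d0; apply: nearW => n.
  by rewrite nr// subrr normr0.
exact: (@norm_cvg_unique _ R[i]^o _ _ _ _ h1 h2).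
Qed.

(** The graph of the antilinear map sending R(z) mu to R(conj z) mu. It is a relation because one
    vector may have several expansions; by the isometry [conj_span_dist] its image does not depend
    on the choice. *)
Definition conj_span (x y : H) : Prop :=
  exists (n : nat) (c z : 'I_n -> R[i]), [/\ forall i, resolvent_set A (z i),
    x = \sum_(i < n) c i *: resolvent A (z i) mu &
    y = \sum_(i < n) (c i)^* *: resolvent A (z i)^* mu].

(** Moving resolvents to the right turns both sides into <mu, R(z) R(conj w) mu>, up to commuting
    the two resolvents. *)
Lemma ip_resolvent_conj (z w : R[i]) : resolvent_set A z -> resolvent_set A w ->
  <<resolvent A z^* mu, resolvent A w^* mu>> = <<resolvent A z mu, resolvent A w mu>>^*.
Proof.
move=> rz rw; have rzJ := resolvent_set_conj rz; have rwJ := resolvent_set_conj rw.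
rewrite ipC !(resolvent_adjoint A_sa) ?conjCK//.
by rewrite resolventC.
Qed.

Lemma conj_span_resolvent (x y : H) (z : R[i]) : conj_span x y -> resolvent_set A z ->
  <<resolvent A z^* mu, y>> = <<resolvent A z mu, x>>^*.
Proof.
move=> [n [c [v [rv -> ->]]]] rz; rewrite !ip_sumr rmorph_sum /=.
by apply: eq_bigr => i _; rewrite rmorphM /= ip_resolvent_conj.
Qed.

Lemma conj_span_ip (x y x' y' : H) : conj_span x y -> conj_span x' y' ->
  <<y, y'>> = <<x, x'>>^*.
Proof.
move=> xy [n [c [v [rv -> ->]]]]; rewrite !ip_sumr rmorph_sum /=.
apply: eq_bigr => i _; rewrite rmorphM /=; congr (_ * _).
by rewrite -ipC (conj_span_resolvent xy)// -ipC conjCK ipC.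
Qed.

Lemma conj_span_dist (x y x' y' : H) : conj_span x y -> conj_span x' y' ->
  `|y - y'| = `|x - x'|.
Proof.
move=> xy xy'; apply/eqP; rewrite -(@eqrXn2 _ 2)// !dotP !ipBl !ipBr.
rewrite (conj_span_ip xy xy) (conj_span_ip xy xy').
rewrite (conj_span_ip xy' xy) (conj_span_ip xy' xy') !ipC.
by apply/eqP; ring.
Qed.

(** Finite combinations approximating [phi] have images that form a Cauchy sequence by isometry;
    [psi] is the limit, that is, the image of [phi] under the antiunitary extension. *)
Lemma exists_conjugate_vector (phi : H) : exists psi, forall z, resolvent_set A z ->
  <<resolvent A z^* mu, psi>> = <<resolvent A z mu, phi>>^*.
Proof.
have /choice[x xP] (n : nat) : exists p, conj_span p.1 p.2 /\ `|phi - p.1| < n.+1%:R^-1.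
  have n0 : 0 < (n.+1%:R^-1 : R[i]) by rewrite invr_gt0.
  have [|y []] := mu_cyclic (O := ball phi n.+1%:R^-1) _ (ball_open _ _).
    by exists phi; exact: ballxx.
  rewrite -ball_normE /= => hy [m [c [v [vR yE]]]].
  have /choice[z zP] i : exists z, resolvent_set A z /\ resolvent A z mu = v i.
    by have [z rz <-] := vR i; exists z.
  exists (y, \sum_(i < m) (c i)^* *: resolvent A (z i)^* mu); split=> //=.
  exists m, c, z; split=> // [i|]; first by case: (zP i).
  by rewrite yE; apply: eq_bigr => i _; case: (zP i) => _ ->.
have ycvg : cvg ((fun n => (x n).2) @ \oo).
  apply: cvg_cauchy_seq => e e0.
  have e2 : 0 < e / 2 by rewrite divr_gt0.
  have [N _ Ne] := near_infty_invS_lt e2; exists N => n Nn.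
  rewrite (conj_span_dist (xP N).1 (xP n).1).
  rewrite -(subrKA phi) (splitr e) (le_lt_trans (ler_normD _ _))//.
  by rewrite distrC ltrD// (lt_trans (xP _).2)//;
    [exact: (Ne N (leqnn N))|exact: (Ne n Nn)].
have xcvg : (x n).1 @[n --> \oo] --> phi.
  apply/cvgrPdist_lt => e e0; apply: filterS (near_infty_invS_lt e0) => n.
  exact/lt_trans/(xP n).2.
exists (lim ((fun n => (x n).2) @ \oo)) => z rz.
have h1 : (<<resolvent A z^* mu, (x n).2>> : R[i]^o) @[n --> \oo] -->
  (<<resolvent A z^* mu, lim ((fun n => (x n).2) @ \oo)>> : R[i]^o) by exact: ip_cvgr.
have h2 : (<<resolvent A z^* mu, (x n).2>> : R[i]^o) @[n --> \oo] -->
  (<<resolvent A z mu, phi>>^* : R[i]^o).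
  have /(@cvgrPdist_lt _ R[i]^o) h : (<<resolvent A z mu, (x n).1>> : R[i]^o)
      @[n --> \oo] --> (<<resolvent A z mu, phi>> : R[i]^o) by exact: ip_cvgr.
  apply/(@cvgrPdist_lt _ R[i]^o) => d /h; apply: filterS => n.
  by rewrite (conj_span_resolvent (xP n).1 rz) -rmorphB norm_conjC.
exact: (@norm_cvg_unique _ R[i]^o _ _ _ _ h1 h2).
Qed.

(** * Identities at eigenvalues and the three properties *)

Local Notation Phi := (Phi dot A mu).

Lemma Phi_eq_at_spectrum (phi : H) (l : R[i]^o) (h : R[i]^o -> R[i]^o) (c : R[i]^o) :
  spectrum A l -> (\forall u \near l^', resolvent_set A u -> Phi phi u = h u) ->
  h u @[u --> l^'] --> c -> Phi phi l = c.
Proof.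
move=> sl Phih hc.
have h1 : Phi phi u @[u --> l^'] --> c.
  apply: cvg_trans hc; apply: near_eq_cvg; near=> u; apply/esym.
  have ru : resolvent_set A u by near: u; exact: (near_dnbhs_spectrum).
  by move: ru; near: u.
have h2 : Phi phi u @[u --> l^'] --> Phi phi l by exact: cvg_Phi_spectrum.
exact: (@norm_cvg_unique _ R[i]^o _ _ _ _ h2 h1).
Unshelve. all: by end_near.
Qed.

Lemma PhiB (x y : H) (z : R[i]^o) : Phi (x - y) z = Phi x z - Phi y z.
Proof. exact: ipBr. Qed.

Lemma Phi_conj (phi psi : H) (z : R[i]^o) :
  (forall u, resolvent_set A u ->
     <<resolvent A u^* mu, psi>> = <<resolvent A u mu, phi>>^*) ->
  Phi psi z = ((Phi phi (z : R[i])^*) : R[i])^*.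
Proof.
move=> phipsi.
have res u : resolvent_set A u -> Phi psi u = ((Phi phi (u : R[i])^*) : R[i])^*.
  move=> ru; have ruJ := resolvent_set_conj ru.
  rewrite !(Phi_resolvent)// rmorphM fmorphV /=.
  rewrite weylF_conj//; congr (_ * _).
  by have := phipsi u ru; rewrite !(resolvent_adjoint A_sa) ?conjCK//.
have [/res//|sz] := pselect (resolvent_set A z).
apply: (@Phi_eq_at_spectrum psi z (fun u => ((Phi phi (u : R[i])^*) : R[i])^*)
  (((Phi phi (z : R[i])^*) : R[i])^*) sz).
  by apply: nearW => u; exact: res.
have zJ : (z : R[i])^* = z by exact/CrealP/(spectrum_real sz).
have h : Phi phi u @[u --> z^'] --> Phi phi (z : R[i])^*.
  by rewrite zJ; exact: cvg_Phi_spectrum.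
have {}h : Phi phi (u : R[i])^* @[u --> z^'] --> Phi phi (z : R[i])^*.
  by apply: cvg_comp h; rewrite -{2}zJ; exact: cvg_conj_dnbhs.
apply/(@cvgrPdist_lt _ R[i]^o) => d d0.
move/(@cvgrPdist_lt _ R[i]^o)/(_ d d0) : h; apply: filterS => u.
by rewrite -rmorphB norm_conjC.
Qed.

Lemma Hhat_evaluation_continuous (z : R[i]^o) : ~ spectrum_infty dot A mu z ->
  Hhat_continuous dot A mu (fun f => f z).
Proof.
move=> sz f [phi fphi] e e0.
(* Cauchy-Schwarz bounds the evaluation by |xi z|; adding 1 makes the divisor positive. *)
exists (e / (`|xi dot A mu z| + 1)); first by rewrite divr_gt0// ltr_wpDl.
move=> g [psi gpsi].
have gf : represents dot A mu (psi - phi) (g - f).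
  by move=> u su; rewrite PhiB -gpsi// -fphi.
(* [Hhat_norm] selects some preimage; by injectivity of [Phi] it is psi - phi. *)
have -> : Hhat_norm dot A mu (g - f) = `|psi - phi|.
  rewrite /Hhat_norm; congr `|_|; apply/esym/subr0_eq.
  apply: (Phi_inj) => u su; rewrite PhiB -gf//.
  have rx : represents dot A mu (xget 0 [set x | represents dot A mu x (g - f)]) (g - f).
    by apply: (@xgetPex _ 0 [set x | represents dot A mu x (g - f)]); exists (psi - phi).
  by rewrite -rx// subrr.
rewrite ltr_pdivlMr ?ltr_wpDl// => h.
have -> : g z - f z = Phi (psi - phi) z by rewrite -gf.
apply: le_lt_trans (CauchySchwarz_ip dotP _ _) _; apply: le_lt_trans h.
by rewrite mulrC ler_wpM2l// lerDl.
Qed.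

Lemma Hhat_conj (f : R[i]^o -> R[i]^o) : Hhat dot A mu f ->
  Hhat dot A mu (fun z => ((f (z : R[i])^* : R[i])^*)).
Proof.
move=> [phi fphi].
have [psi psiP] := exists_conjugate_vector phi.
exists psi => z sz; rewrite (Phi_conj _ psiP) fphi// => szJ.
by apply: sz; have := szJ; rewrite -(spectrum_infty_real szJ) conjCK.
Qed.

Lemma Hhat_swap_zero (f : R[i]^o -> R[i]^o) (w : R[i]^o) :
  Hhat dot A mu f -> (w : R[i]) \isn't Num.real -> f w = 0 ->
  Hhat dot A mu (swap_zero f w).
Proof.
move=> [phi fphi] wr fw; have rw := nonreal_resolvent_set wr.
(* [weylF] does not vanish at [w], so the zero of [f] comes from the numerator of [Phi phi]. *)
have phiw : <<mu, resolvent A w phi>> = 0.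
  have := fphi w (nonreal_spectrum_infty wr); rewrite fw Phi_resolvent//.
  move/(congr1 (fun a : R[i] => weylF dot A mu w * a)).
  by rewrite mulVKf ?weylF_nonreal// mulr0.
pose psi := phi + (w - (w : R[i])^*) *: resolvent A w phi.
have res u : resolvent_set A u -> u != w ->
    Phi psi u = (u - (w : R[i])^*) / (u - w) * Phi phi u.
  move=> ru uw; have uw0 : u - w != 0 by rewrite subr_eq0.
  rewrite !(Phi_resolvent)// mulrCA; congr (_ * _).
  rewrite /psi (resolventD ru) (resolventZ ru) ipDr ipZr.
  (* The term <mu, R(w) phi> of the resolvent identity vanishes, so <mu, R(u) psi> is <mu, R(u) phi>
     times 1 + (w - conj w) / (u - w), which is the desired factor. *)
  have : (u - w) * <<mu, resolvent A u (resolvent A w phi)>> = <<mu, resolvent A u phi>>.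
    by rewrite -ipZr -resolvent_identity// ipBr phiw subr0.
  by move=> <-; field.
exists psi => z sz; rewrite /swap_zero; case: eqVneq => [->|zw].
  (* The removed singularity takes the value [Phi psi w], because around [w] the quotient agrees
     with [Phi psi], which is continuous there. *)
  apply: cvg_lim; first exact: (@norm_hausdorff _ R[i]^o).
  have h : Phi psi u @[u --> w^'] --> Phi psi w.
    exact: (cvg_Phi_nonreal).
  apply: cvg_trans h; apply: near_eq_cvg; near=> u.
  have uw : u != w by near: u; exact: nbhs_dnbhs_neq.
  have ur : (u : R[i]) \isn't Num.real by near: u; exact: near_nonreal.
  rewrite res ?fphi//; [exact: nonreal_spectrum_infty|].
  exact: (nonreal_resolvent_set).
rewrite fphi//; apply/esym.
have [rz|sz'] := pselect (resolvent_set A z); first exact: res.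
apply: (@Phi_eq_at_spectrum psi z (fun u => (u - (w : R[i])^*) / (u - w) * Phi phi u)
  ((z - (w : R[i])^*) / (z - w) * Phi phi z) sz').
  near=> u => ru; apply: res => //.
  apply: contraTneq (_ : `|u - z| < `|w - z|) => [->|]; first by rewrite ltxx.
  have [] // : u != z /\ `|u - z| < `|w - z|.
  by near: u; apply: near_dnbhs_dist; rewrite normr_gt0 subr_eq0 eq_sym.
have h : Phi phi u @[u --> z^'] --> Phi phi z by exact: cvg_Phi_spectrum.
apply: cvgM h; apply: (@cvgM _ R[i]^o).
  by apply: cvgB; [exact: nbhs_dnbhs|exact: (@cvg_cst R[i]^o)].
apply: cvgV; first by rewrite subr_eq0.
by apply: cvgB; [exact: nbhs_dnbhs|exact: (@cvg_cst R[i]^o)].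
Unshelve. all: by end_near.
Qed.

End FunctionalModel.

Theorem lemma2 (R : realType) (H : completeNormedModType R[i])
    (dot : {dot H for @Num.conj R[i]}) (A : unbounded_op H) (mu : H)
    (H_inner : inner_product_norm dot)
    (H_separable : separable_space H)
    (A_self_adjoint : self_adjoint dot A)
    (A_discrete : discrete_simple_spectrum A)
    (mu_cyclic : cyclic_vector A mu)
    (mu_unit : `|mu| = 1) :
  [/\ forall (f : R[i]^o -> R[i]^o) (w : R[i]^o),
        Hhat dot A mu f -> w \isn't Num.real -> f w = 0 ->
        Hhat dot A mu (swap_zero f w),
      forall z : R[i]^o, ~ spectrum_infty dot A mu z ->
        Hhat_continuous dot A mu (fun f => f z) &
      forall f : R[i]^o -> R[i]^o, Hhat dot A mu f ->
        Hhat dot A mu (fun z => (f z^*)^*)].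
Proof.
have mu0 : mu != 0 by rewrite -normr_eq0 mu_unit oner_eq0.
split.
- exact: Hhat_swap_zero.
- exact: Hhat_evaluation_continuous.
- exact: Hhat_conj.
Qed.
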